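(* Let $H$ be a cosemisimple bialgebra over a field $\mathbf{k}$, with left cointegral $\chi\in H^*$ satisfying $\chi(1_H)=1$. Let $M$ be a left, right $H$-dimodule and let $T:M\to M$ be defined by $$T(m)=m_{(0)}\chi(m_{(1)}).$$ Then $(M,T)$ is a generic Rota-Baxter paired $H$-module of weight $-1$.
   Context: The right $H$-coaction on $M$ is written $\rho(m)=m_{(0)}\otimes m_{(1)}$. The dual $H^*$ is an algebra under the convolution product $(fg)(h)=f(h_1)g(h_2)$, where $\Delta(h)=h_1\otimes h_2$, and $\varepsilon_{H^*}(f)=f(1_H)$. A left cointegral is an element $\chi\in H^*$ with $f\chi=\varepsilon_{H^*}(f)\chi$ for all $f\in H^*$. In this paper a bialgebra $H$ is called cosemisimple if it has a left cointegral $\chi$ with $\varepsilon_{H^*}(\chi)=\chi(1_H)=1$. A left, right $H$-dimodule is a $\mathbf{k}$-module $M$ that is both a left $H$-module and a right $H$-comodule such that $\rho(h\cdot m)=h\cdot m_{(0)}\otimes m_{(1)}$ for all $h\in H$, $m\in M$. For an algebra $B$, a left $B$-module $M$ and $\mathbf{k}$-linear maps $P:B\to B$, $T:M\to M$, the triple $(M,P,T)$ is a Rota-Baxter paired $B$-module of weight $\lambda\in\mathbf{k}$ if $$P(b)\cdot T(m)=T(P(b)\cdot m)+T(b\cdot T(m))+\lambda T(b\cdot m)\quad\text{for all } b\in B,\ m\in M.$$ The pair $(M,T)$ is a generic Rota-Baxter paired $B$-module of weight $\lambda$ if this holds for every $\mathbf{k}$-linear map $P:B\to B$. *)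

(* Defs.v *)
From HB Require Import structures.
From mathcomp Require Import all_boot all_algebra.
From mathcomp Require Import generic_quotient ring_quotient sesquilinear.
From mathcomp Require Import boolp.
From mathcomp Require Import freeg.

Set Implicit Arguments.
Unset Strict Implicit.
Unset Printing Implicit Defensive.

Import GRing.Theory.
Local Open Scope ring_scope.
Local Open Scope quotient_scope.

Reserved Notation "M ⊗ N" (at level 40, left associativity).
Reserved Notation "h ∙ m" (at level 40, left associativity).

Local Notation is_bilinear := (bilinear_for
  (GRing.Scale.Law.clone _ _ *:%R _) (GRing.Scale.Law.clone _ _ *:%R _)).

Section FreeLift.
Context {R : comNzRingType} {K : choiceType} {P : lmodType R} (f : K -> P).

Lemma fglift_linear : linear (fglift f : {freeg K / R} -> P).
Proof.
move=> a x y.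
have fB : zmod_morphism (fglift f) by apply: lift_is_additive.
have f0 : fglift f 0 = 0 by rewrite -(subrr 0) fB subrr.
have fN u : fglift f (- u) = - fglift f u by rewrite -sub0r fB f0 sub0r.
have fD u v : fglift f (u + v) = fglift f u + fglift f v.
  by rewrite -[v in LHS]opprK fB fN opprK.
have fsum (I : Type) (r : seq I) (F : I -> {freeg K / R}) :
    fglift f (\sum_(i <- r) F i) = \sum_(i <- r) fglift f (F i).
  by elim/big_rec2: _ => // i u v _ <-; rewrite fD.
rewrite fD; congr (_ + _).
rewrite -[x in RHS]freeg_sumE fsum scaler_sumr.
by rewrite [a *: x]/(fgscale a x) /fgscale fsum; apply: eq_bigr => z _; rewrite !liftU scalerA.
Qed.

HB.instance Definition _ :=
  GRing.isLinear.Build R {freeg K / R} P _ (fglift f) fglift_linear.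
End FreeLift.

(* M ⊗ N is the quotient of the free module on the set M * N by the submodule
   generated by the bilinearity relations. *)
Section Tensor.
Context {R : comNzRingType} (M N : lmodType R).

Local Notation F := {freeg (M * N)%type / R}.

Inductive tensor_null : F -> Prop :=
| tensor_null0 : tensor_null 0
| tensor_nullP a x y :
    tensor_null x -> tensor_null y -> tensor_null (a *: x + y)
| tensor_null_l a m m' n :
    tensor_null (<< (a *: m + m', n) >> - (a *: << (m, n) >> + << (m', n) >>))
| tensor_null_r a m n n' :
    tensor_null (<< (m, a *: n + n') >> - (a *: << (m, n) >> + << (m, n') >>)).

Definition tensor_rel : {pred F} := fun x => `[< tensor_null x >].

Lemma tensor_rel_submod : submod_closed tensor_rel.
Proof.
split=> [|a x y /asboolP x0 /asboolP y0]; apply/asboolP.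
  exact: tensor_null0.
exact: tensor_nullP.
Qed.

HB.instance Definition _ :=
  GRing.isSubmodClosed.Build R F tensor_rel tensor_rel_submod.

Definition tensor : Type := Quotient.quot tensor_rel.
HB.instance Definition _ := GRing.Zmodule.on tensor.
HB.instance Definition _ := generic_quotient.Quotient.on tensor.

Lemma tensor_pi_eq0 (x : F) : (\pi_tensor x == 0) = `[< tensor_null x >].
Proof.
rewrite -[in RHS](subr0 x) -[`[< _ >]]/(x - 0 \in tensor_rel) Quotient.idealrBE.
by rewrite -(raddf0 \pi_(Quotient.quot tensor_rel)).
Qed.

Lemma pi_tensor0 : \pi_tensor 0 = 0.
Proof. by apply/eqP; rewrite tensor_pi_eq0; apply/asboolP; exact: tensor_null0. Qed.

Lemma pi_tensorD (x y : F) : \pi_tensor (x + y) = \pi_tensor x + \pi_tensor y.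
Proof. exact: (Quotient.pi_add tensor_rel x y). Qed.

Lemma pi_tensorN (x : F) : \pi_tensor (- x) = - \pi_tensor x.
Proof. exact: (Quotient.pi_opp tensor_rel x). Qed.

Definition tensor_scale (a : R) (t : tensor) : tensor :=
  \pi_tensor (a *: repr t).

Lemma pi_tensor_scale a (x : F) :
  tensor_scale a (\pi_tensor x) = \pi_tensor (a *: x).
Proof.
apply/eqP; rewrite -[_ == _]/(\pi_(Quotient.quot tensor_rel) _ == \pi_(Quotient.quot tensor_rel) _).
rewrite -Quotient.idealrBE -scalerBr rpredZ // Quotient.idealrBE.
by rewrite -[X in X == _]/(\pi_tensor _) reprK.
Qed.

Fact tensor_scaleA a b t :
  tensor_scale a (tensor_scale b t) = tensor_scale (a * b) t.
Proof. by elim/quotW: t => x; rewrite (pi_tensor_scale b x) !pi_tensor_scale scalerA. Qed.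
Fact tensor_scale1 : left_id 1 tensor_scale.
Proof. by elim/quotW=> x; rewrite pi_tensor_scale scale1r. Qed.
Fact tensor_scaleDr : right_distributive tensor_scale +%R.
Proof.
move=> a; elim/quotW=> x; elim/quotW=> y.
by rewrite -pi_tensorD pi_tensor_scale scalerDr pi_tensorD (pi_tensor_scale a x) (pi_tensor_scale a y).
Qed.
Fact tensor_scaleDl t : {morph tensor_scale^~ t : a b / a + b}.
Proof.
by move=> a b; elim/quotW: t => x; rewrite pi_tensor_scale scalerDl pi_tensorD (pi_tensor_scale a x) (pi_tensor_scale b x).
Qed.

HB.instance Definition _ := GRing.Zmodule_isLmodule.Build R tensor
  tensor_scaleA tensor_scale1 tensor_scaleDr tensor_scaleDl.

Lemma pi_tensorZ a (x : F) : \pi_tensor (a *: x) = a *: \pi_tensor x.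
Proof. by rewrite -pi_tensor_scale. Qed.

Definition tens (m : M) (n : N) : tensor := \pi_tensor << (m, n) >>.

Lemma tens_bilinear : is_bilinear tens.
Proof.
split=> [n | m] a x y /=; apply/eqP; rewrite -subr_eq0;
  rewrite /tens -pi_tensorZ -pi_tensorD -pi_tensorN -pi_tensorD tensor_pi_eq0;
  apply/asboolP.
  exact: tensor_null_l.
exact: tensor_null_r.
Qed.

HB.instance Definition _ :=
  bilinear_isBilinear.Build R M N tensor _ _ tens tens_bilinear.
End Tensor.

Notation "M ⊗ N" := (tensor M N).

Section TensorLift.
Context {R : comNzRingType} {M N P : lmodType R}.

Definition tensor_lift (f : {bilinear M -> N -> P}) (t : M ⊗ N) : P :=
  fglift (fun mn : M * N => f mn.1 mn.2) (repr t).

Variable f : {bilinear M -> N -> P}.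

Lemma tensor_lift_pi (x : {freeg (M * N)%type / R}) :
  tensor_lift f (\pi_(M ⊗ N) x) = fglift (fun mn : M * N => f mn.1 mn.2) x.
Proof.
have null y : tensor_null y -> fglift (fun mn : M * N => f mn.1 mn.2) y = 0.
  elim=> {y} [|a x' y _ x0 _ y0|a m m' n|a m n n'].
  - exact: raddf0.
  - by rewrite linearP /= x0 y0 scaler0 addr0.
  - by rewrite linearB linearP /= !liftU !scale1r linearPl subrr.
  - by rewrite linearB linearP /= !liftU !scale1r linearPr subrr.
apply/eqP; rewrite -subr_eq0 -raddfB; apply/eqP/null/asboolP.
by rewrite -tensor_pi_eq0 pi_tensorD pi_tensorN reprK subrr.
Qed.

Lemma tensor_lift_linear : linear (tensor_lift f).
Proof.
move=> a; elim/quotW=> x; elim/quotW=> y.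
by rewrite -pi_tensorZ -pi_tensorD !tensor_lift_pi linearP.
Qed.

HB.instance Definition _ :=
  GRing.isLinear.Build R (M ⊗ N) P _ (tensor_lift f) tensor_lift_linear.

Lemma tensor_liftE m n : tensor_lift f (tens m n) = f m n.
Proof. by rewrite tensor_lift_pi liftU scale1r. Qed.
End TensorLift.

Lemma tensor_ind (R : comNzRingType) (M N : lmodType R) (Q : M ⊗ N -> Prop) :
  Q 0 -> (forall m n t, Q t -> Q (tens m n + t)) -> forall t, Q t.
Proof.
move=> Q0 QD; elim/quotW=> x; rewrite -[x]freeg_sumE.
elim: (dom x) => [|[m n] s IHs]; first by rewrite big_nil pi_tensor0.
rewrite big_cons pi_tensorD; move: (coeff _ _) => a.
suff -> : \pi_(M ⊗ N) << a *g (m, n) >> = tens (a *: m) n by apply: QD.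
rewrite linearZl_LR /= /tens -pi_tensorZ; congr (\pi_ _ _).
by apply/eqP/freeg_eqP=> z; rewrite coeffZ !coeffU mulrA mulr1.
Qed.

Lemma tensor_ext (R : comNzRingType) (M N P : lmodType R)
    (f g : {linear M ⊗ N -> P}) :
  (forall m n, f (tens m n) = g (tens m n)) -> f =1 g.
Proof.
by move=> fg; elim/tensor_ind => [|m n t IHt]; rewrite ?raddf0 // !raddfD /= fg IHt.
Qed.

Lemma tensor_lift_comb (R : comNzRingType) (M N P : lmodType R) (a : R)
    (f g h : {bilinear M -> N -> P}) :
    (forall m n, h m n = a *: f m n + g m n) ->
  forall t, tensor_lift h t = a *: tensor_lift f t + tensor_lift g t.
Proof.
move=> hE; elim/tensor_ind => [|m n t IHt]; first by rewrite !raddf0 addr0.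
by rewrite !raddfD /= !tensor_liftE hE IHt addrACA.
Qed.

Section TensorMap.
Context {R : comNzRingType} {M N M' N' : lmodType R}.
Variables (f : {linear M -> M'}) (g : {linear N -> N'}).

Definition tens_map (m : M) (n : N) : M' ⊗ N' := tens (f m) (g n).

Fact tens_map_bilinear : is_bilinear tens_map.
Proof.
by split=> [n | m] a x y; rewrite /tens_map linearP ?linearPl ?linearPr.
Qed.
HB.instance Definition _ :=
  bilinear_isBilinear.Build R M N (M' ⊗ N') _ _ tens_map tens_map_bilinear.

Definition tensor_map : {linear M ⊗ N -> M' ⊗ N'} := tensor_lift tens_map.
End TensorMap.

(* The associativity isomorphism (M ⊗ N) ⊗ P -> M ⊗ (N ⊗ P). *)
Section TensorAssoc.
Context {R : comNzRingType} {M N P : lmodType R}.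

Definition tens_assoc (p : P) (m : M) (n : N) : M ⊗ (N ⊗ P) :=
  tens m (tens n p).

Fact tens_assoc_bilinear p : is_bilinear (tens_assoc p).
Proof.
by split=> [n | m] a x y; rewrite /tens_assoc ?linearPl ?linearPr.
Qed.
HB.instance Definition _ p := bilinear_isBilinear.Build R M N (M ⊗ (N ⊗ P)) _ _
  (tens_assoc p) (tens_assoc_bilinear p).

Definition assoc_at (t : M ⊗ N) (p : P) : M ⊗ (N ⊗ P) :=
  tensor_lift (tens_assoc p) t.

Fact assoc_at_bilinear : is_bilinear assoc_at.
Proof.
split=> [p | t] a x y; first exact: linearP.
by apply: tensor_lift_comb => m n; rewrite /= /tens_assoc !linearPr.
Qed.
HB.instance Definition _ := bilinear_isBilinear.Build R (M ⊗ N) P (M ⊗ (N ⊗ P))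
  _ _ assoc_at assoc_at_bilinear.

Definition tensor_assoc : {linear (M ⊗ N) ⊗ P -> M ⊗ (N ⊗ P)} :=
  tensor_lift assoc_at.
End TensorAssoc.

Section Contraction.
Context {R : comNzRingType} {M N : lmodType R}.

Section OneFunctional.
Variable f : {linear N -> R^o}.

Definition tens_evall (n : N) (m : M) : M := f n *: m.
Definition tens_evalr (m : M) (n : N) : M := f n *: m.

Fact tens_evall_bilinear : is_bilinear tens_evall.
Proof.
split=> [m | n] a x y; rewrite /tens_evall /=.
  by rewrite linearP scalerDl scalerA.
by rewrite scalerDr !scalerA [a * _]mulrC.
Qed.
HB.instance Definition _ := bilinear_isBilinear.Build R N M M _ _
  tens_evall tens_evall_bilinear.

Fact tens_evalr_bilinear : is_bilinear tens_evalr.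
Proof. by split=> [n | m] a x y; case: tens_evall_bilinear => Hl Hr; [exact: Hr|exact: Hl]. Qed.
HB.instance Definition _ := bilinear_isBilinear.Build R M N M _ _
  tens_evalr tens_evalr_bilinear.

Definition tensor_evall : {linear N ⊗ M -> M} := tensor_lift tens_evall.
Definition tensor_evalr : {linear M ⊗ N -> M} := tensor_lift tens_evalr.
End OneFunctional.

Variables (f : {linear M -> R^o}) (g : {linear N -> R^o}).

Definition tens_eval2 (m : M) (n : N) : R^o := f m * g n.

Fact tens_eval2_bilinear : is_bilinear tens_eval2.
Proof.
split=> [n | m] a x y; rewrite /tens_eval2 linearP.
  by rewrite mulrDl -scalerAl.
by rewrite mulrDr -scalerAr.
Qed.
HB.instance Definition _ := bilinear_isBilinear.Build R M N R^o _ _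
  tens_eval2 tens_eval2_bilinear.

Definition tensor_eval2 : {linear M ⊗ N -> R^o} := tensor_lift tens_eval2.
End Contraction.

(* The product of the algebra A ⊗ B: (a ⊗ b)(a' ⊗ b') = aa' ⊗ bb'. *)
Section TensorMul.
Context {R : comNzRingType} {A B : algType R}.

Definition tens_mul (a' : A) (b' : B) (a : A) (b : B) : A ⊗ B :=
  tens (a * a') (b * b').

Fact tens_mul_bilinear a' b' : is_bilinear (tens_mul a' b').
Proof.
by split=> [b | a] c x y; rewrite /tens_mul mulrDl -scalerAl ?linearPl ?linearPr.
Qed.
HB.instance Definition _ a' b' := bilinear_isBilinear.Build R A B (A ⊗ B) _ _
  (tens_mul a' b') (tens_mul_bilinear a' b').

Definition tensor_mul_tens (s : A ⊗ B) (a' : A) (b' : B) : A ⊗ B :=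
  tensor_lift (tens_mul a' b') s.

Fact tensor_mul_tens_bilinear s : is_bilinear (tensor_mul_tens s).
Proof.
split=> [b' | a'] c x y; apply: tensor_lift_comb => a b /=;
  by rewrite /tens_mul mulrDr -scalerAr ?linearPl ?linearPr.
Qed.
HB.instance Definition _ s := bilinear_isBilinear.Build R A B (A ⊗ B) _ _
  (tensor_mul_tens s) (tensor_mul_tens_bilinear s).

Definition tensor_mul (s t : A ⊗ B) : A ⊗ B := tensor_lift (tensor_mul_tens s) t.
End TensorMul.

(* The algType hypothesis 1 != 0 costs no generality: counit1 already excludes
   the zero ring. *)
HB.mixin Record isBialgebra (k : comNzRingType) H of GRing.Algebra k H := {
  comul : {linear H -> H ⊗ H};
  counit : {linear H -> k^o};
  comulA : forall h,
    tensor_assoc (tensor_map comul idfun (comul h)) =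
    tensor_map idfun comul (comul h);
  counitl : forall h, tensor_evall counit (comul h) = h;
  counitr : forall h, tensor_evalr counit (comul h) = h;
  comul1 : comul 1 = tens 1 1;
  comulM : forall g h, comul (g * h) = tensor_mul (comul g) (comul h);
  counit1 : counit 1 = 1;
  counitM : forall g h, counit (g * h) = counit g * counit h
}.
#[short(type="bialgType")]
HB.structure Definition Bialgebra (k : comNzRingType) :=
  {H of isBialgebra k H & GRing.Algebra k H}.

(* A left module over the k-algebra B is a k-module with a k-bilinear action;
   it is kept distinct from GRing.Lmodule B, which would not know about k. *)
HB.mixin Record isLeftModule (k : comNzRingType) (B : algType k) M
    of GRing.Lmodule k M := {
  act : {bilinear B -> M -> M};
  act1 : forall m, act 1 m = m;
  actM : forall a b m, act (a * b) m = act a (act b m)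
}.
#[short(type="leftModType")]
HB.structure Definition LeftModule (k : comNzRingType) (B : algType k) :=
  {M of isLeftModule k B M & GRing.Lmodule k M}.

HB.mixin Record isRightComodule (k : comNzRingType) (H : bialgType k) M
    of GRing.Lmodule k M := {
  coact : {linear M -> M ⊗ H};
  coactA : forall m,
    tensor_assoc (tensor_map coact idfun (coact m)) =
    tensor_map idfun comul (coact m);
  coact_counit : forall m, tensor_evalr counit (coact m) = m
}.
#[short(type="rightComodType")]
HB.structure Definition RightComodule (k : comNzRingType) (H : bialgType k) :=
  {M of isRightComodule k H M & GRing.Lmodule k M}.

HB.mixin Record isDimodule (k : comNzRingType) (H : bialgType k) M
    of LeftModule k H M & RightComodule k H M := {
  coact_act : forall (h : H) (m : M),
    coact (act h m) = tensor_map (act h) idfun (coact m)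
}.
#[short(type="dimodType")]
HB.structure Definition Dimodule (k : comNzRingType) (H : bialgType k) :=
  {M of isDimodule k H M & LeftModule k H M & RightComodule k H M}.

Notation "h ∙ m" := (act h m) : ring_scope.

Section Dual.
Context {k : comNzRingType} {H : bialgType k}.
Implicit Types f g chi : {linear H -> k^o}.

(* The product of the dual algebra: (f g)(h) = f(h_1) g(h_2). *)
Definition convolution f g : {linear H -> k^o} := tensor_eval2 f g \o comul.

Definition dual_counit f : k := f 1.

Definition left_cointegral chi : Prop :=
  forall f h, convolution f chi h = dual_counit f * chi h.
End Dual.

Definition cosemisimple (k : comNzRingType) (H : bialgType k) : Prop :=
  exists2 chi : {linear H -> k^o}, left_cointegral chi & dual_counit chi = 1.

(* m |-> m_(0) chi(m_(1)) *)
Definition coact_eval (k : comNzRingType) (H : bialgType k)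
    (M : rightComodType H) (chi : {linear H -> k^o}) : {linear M -> M} :=
  tensor_evalr chi \o coact.

Section RotaBaxter.
Context {k : comNzRingType} {B : algType k} (M : leftModType B).

Definition RotaBaxter_paired (lambda : k) (P : {linear B -> B})
    (T : {linear M -> M}) : Prop :=
  forall (b : B) (m : M),
    P b ∙ T m = T (P b ∙ m) + T (b ∙ T m) + lambda *: T (b ∙ m).

Definition generic_RotaBaxter_paired (lambda : k) (T : {linear M -> M}) : Prop :=
  forall P : {linear B -> B}, RotaBaxter_paired lambda P T.
End RotaBaxter.
Arguments generic_RotaBaxter_paired {k B} M lambda T.

(* Main.v *)
Require Import Defs.
From mathcomp Require Import all_boot all_algebra.
Import GRing.Theory.
Local Open Scope ring_scope.

(** The dimodule compatibility makes [T] a morphism of [H]-modules. Evaluating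
    the comodule along functionals is an action of the algebra [H^*], and
    [chi chi = chi(1) chi = chi], so [T] is idempotent. Hence for any [P],
    [T (b T m) - T (b m) = b (T (T m) - T m) = 0] and
    [T (P b m) = P b T m]. *)

Lemma tensor_evalr_tens (k : comNzRingType) (M N : lmodType k)
    (f : {linear N -> k^o}) (m : M) (n : N) :
  tensor_evalr f (tens m n) = f n *: m.
Proof. exact: tensor_liftE. Qed.

Lemma tensor_map_tens (k : comNzRingType) (M N M' N' : lmodType k)
    (f : {linear M -> M'}) (g : {linear N -> N'}) (m : M) (n : N) :
  tensor_map f g (tens m n) = tens (f m) (g n).
Proof. exact: tensor_liftE. Qed.

(** [g] is tied to [f \o v] only pointwise, so one lemma covers both [v = comul], where [g] is a
    convolution, and [v = idfun], where [g] is [f]. *)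
Lemma tensor_evalr_map (k : comNzRingType) (M M' N N' : lmodType k)
    (u : {linear M -> M'}) (v : {linear N -> N'})
    (f : {linear N' -> k^o}) (g : {linear N -> k^o}) :
  (forall n, f (v n) = g n) ->
  forall t, tensor_evalr f (tensor_map u v t) = u (tensor_evalr g t).
Proof.
move=> fvg; elim/tensor_ind => [|m n t IHt]; first by rewrite !raddf0.
by rewrite !linearD IHt tensor_map_tens !tensor_evalr_tens fvg linearZ.
Qed.

(** For [t = tens m n] both sides are [f n * g p] times [m]. The factor [t] stays arbitrary because
    it will be the coaction of an element, which need not be a pure tensor. *)
Lemma tensor_evalr_assoc (k : comNzRingType) (M N P : lmodType k)
    (f : {linear N -> k^o}) (g : {linear P -> k^o}) (t : M ⊗ N) (p : P) :
  tensor_evalr (tensor_eval2 f g) (tensor_assoc (tens t p)) =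
  g p *: tensor_evalr f t.
Proof.
have -> : tensor_assoc (tens t p) = tensor_lift (tens_assoc p) t.
  exact: tensor_liftE.
elim/tensor_ind: t => [|m n t IHt]; first by rewrite !raddf0.
rewrite 2!linearD [tensor_evalr f _]linearD scalerDr IHt tensor_evalr_tens.
congr (_ + _); rewrite [X in tensor_evalr _ X]tensor_liftE tensor_evalr_tens.
by rewrite [tensor_eval2 f g _]tensor_liftE scalerA mulrC.
Qed.

(** Both sides are [m_(0) f(m_(1)) g(m_(2))]: coassociativity rebrackets [M ⊗ (H ⊗ H)] as
    [(M ⊗ H) ⊗ H]. *)
Lemma coact_eval_convolution (k : comNzRingType) (H : bialgType k)
    (M : rightComodType H) (f g : {linear H -> k^o}) (m : M) :
  coact_eval M (convolution f g) m = coact_eval M f (coact_eval M g m).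
Proof.
have -> : coact_eval M (convolution f g) m =
    tensor_evalr (tensor_eval2 f g) (tensor_map idfun comul (coact m)).
  by rewrite (@tensor_evalr_map _ _ _ _ _ _ _ _ (convolution f g)).
rewrite -coactA [RHS]/=.
elim/tensor_ind: (coact m) => [|n h t IHt]; first by rewrite !raddf0.
rewrite !linearD IHt tensor_map_tens tensor_evalr_assoc tensor_evalr_tens.
by rewrite !linearZ.
Qed.

(** The action touches only the left leg of [coact m], and [f] only the right one. *)
Lemma coact_eval_act (k : comNzRingType) (H : bialgType k) (M : dimodType H)
    (f : {linear H -> k^o}) (h : H) (m : M) :
  coact_eval M f (h ∙ m) = h ∙ coact_eval M f m.
Proof. by rewrite /= coact_act (@tensor_evalr_map _ _ _ _ _ _ _ _ f). Qed.

Lemma coact_eval_idem (k : comNzRingType) (H : bialgType k)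
    (M : rightComodType H) (chi : {linear H -> k^o}) (m : M) :
  left_cointegral chi -> chi 1 = 1 ->
  coact_eval M chi (coact_eval M chi m) = coact_eval M chi m.
Proof.
move=> chiP chi1; rewrite -coact_eval_convolution.
(* The cointegral identity is pointwise, so the two evaluations are compared on pure tensors. *)
apply: tensor_ext => n h.
by rewrite !tensor_evalr_tens chiP /dual_counit chi1 mul1r.
Qed.

Theorem corollary3p11 (k : fieldType) (H : bialgType k)
    (chi : {linear H -> k^o}) (M : dimodType H) :
  cosemisimple H ->
  left_cointegral chi ->
  chi 1 = 1 ->
  generic_RotaBaxter_paired M (-1) (coact_eval M chi).
Proof.
move=> _ chiP chi1 P b m.
by rewrite !coact_eval_act coact_eval_idem // scaleN1r addrK.
Qed.
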